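(* Let $V$ be a complex inner product space of finite dimension $\dim V\geq 2$. Suppose $G=\langle\sigma_1\rangle\langle\sigma_2\rangle\cdots\langle\sigma_k\rangle\le S_m$, $k\geq 2$, where $\sigma_\ell$, $\ell=1,\ldots,k$, are disjoint cycles in $S_m$ of orders $m_1,\ldots,m_k$, respectively. Let $\lambda=\lambda_{(q_1,\ldots,q_k)}$, where $0\le q_\ell\le m_\ell-1$ for $1\le\ell\le k$. Then $$\dim V^{\lambda}(G)=(\dim V)\left[\Big(m-\sum_{\ell=1}^{k}m_\ell\Big)[\lambda,1_G]+\sum_{j=1}^{k}\ \prod_{\substack{1\le\ell\le k\\ \ell\neq j}}\frac{1}{m_\ell}\sum_{d\mid m_\ell}c_{m_\ell/d}(q_\ell)\right].$$ In the case $k=1$ (that is, $G=\langle\sigma_1\rangle$ and $\lambda=\lambda_{q_1}$), $\dim V^{\lambda}(G)=(\dim V)\big[(m-m_1)[\lambda,1_G]+1\big]$.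
   Context: $\times^m V$ is the Cartesian product of $m$ copies of $V$. For $\tau\in G\le S_m$, $Q(\tau):\times^m V\to\times^m V$ is the linear operator $Q(\tau)(u_1,\ldots,u_m)=(u_{\tau^{-1}(1)},\ldots,u_{\tau^{-1}(m)})$. For a complex irreducible character $\lambda$ of $G$, the Cartesian symmetrizer is $C_\lambda=\frac{\lambda(1)}{|G|}\sum_{\tau\in G}\lambda(\tau)Q(\tau)$, and the Cartesian symmetry class associated with $G$ and $\lambda$ is the range $V^\lambda(G)=C_\lambda(\times^m V)$. The irreducible characters of $G=\langle\sigma_1\rangle\cdots\langle\sigma_k\rangle$ are the linear characters $\lambda_{(q_1,\ldots,q_k)}=\lambda_{q_1}\cdots\lambda_{q_k}$, where $\lambda_{q_\ell}(\sigma_\ell^{j_\ell})=\exp\left(\frac{2\pi\sqrt{-1}\,q_\ell j_\ell}{m_\ell}\right)$; that is, $\lambda_{(q_1,\ldots,q_k)}(\sigma_1^{j_1}\cdots\sigma_k^{j_k})=\prod_{\ell=1}^k\exp\left(\frac{2\pi\sqrt{-1}\,q_\ell j_\ell}{m_\ell}\right)$. $1_G$ is the principal character of $G$ and $[\lambda,1_G]=\frac{1}{|G|}\sum_{g\in G}\lambda(g)$. For a positive integer $t$ and a non-negative integer $q$, the Ramanujan sum is $c_t(q)=\sum_{0\le s\le t-1,\ \gcd(s,t)=1}\exp\left(\frac{2\pi\sqrt{-1}\,qs}{t}\right)$ (so $c_1(q)=1$). In the formula, each factor of the product over $\ell\neq j$ is $\frac{1}{m_\ell}\sum_{d\mid m_\ell}c_{m_\ell/d}(q_\ell)$.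 *)

(* Defs.v *)
From HB Require Import structures.
From mathcomp Require Import all_boot all_order all_algebra all_fingroup.
From mathcomp Require Import cyclic sesquilinear complex.
From mathcomp Require Import all_classical all_reals all_analysis.

Set Implicit Arguments.
Unset Strict Implicit.
Unset Printing Implicit Defensive.

Import Order.TTheory GRing.Theory Num.Theory.
Local Open Scope ring_scope.

(* Neither the libraries' cosine and sine series nor [R[i]] come with a complex
   exponential; [expi x] is exp(sqrt(-1) x) for a real [x]. *)
Definition expi (R : realType) (x : R) : R[i] := Complex (cos x) (sin x).

Definition ramanujan_sum (R : realType) (t q : nat) : R[i] :=
  \sum_(s < t | coprime s t) expi (2 * pi * q%:R * s%:R / t%:R : R).

Section CartesianSymmetryClass.
Variables (R : realType) (V : vectType R[i]) (m : nat).

Definition perm_ffun (tau : 'S_m) (u : {ffun 'I_m -> V}) : {ffun 'I_m -> V} :=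
  [ffun i => u ((tau^-1)%g i)].

Lemma perm_ffun_is_linear (tau : 'S_m) : linear (perm_ffun tau).
Proof. by move=> a u v; apply/ffunP => i; rewrite !ffunE. Qed.

HB.instance Definition _ (tau : 'S_m) :=
  GRing.isLinear.Build R[i] {ffun 'I_m -> V} {ffun 'I_m -> V} _
    (perm_ffun tau) (perm_ffun_is_linear tau).

Definition Qperm (tau : 'S_m) : 'End({ffun 'I_m -> V}) :=
  linfun (perm_ffun tau).

Lemma QpermE tau u i : Qperm tau u i = u ((tau^-1)%g i).
Proof. by rewrite lfunE ffunE. Qed.

(* Only the values of [lambda] on [G] matter, here and in [char_dot1]. *)
Definition cart_symmetrizer (G : {group 'S_m}) (lambda : 'S_m -> R[i]) :
    'End({ffun 'I_m -> V}) :=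
  (lambda 1%g / #|G|%:R) *: \sum_(tau in G) lambda tau *: Qperm tau.

Definition cart_symmetry_class (G : {group 'S_m}) (lambda : 'S_m -> R[i]) :
    {vspace {ffun 'I_m -> V}} :=
  limg (cart_symmetrizer G lambda).

End CartesianSymmetryClass.

Arguments cart_symmetrizer {R} V {m} G lambda.
Arguments cart_symmetry_class {R} V {m} G lambda.

Definition char_dot1 (R : realType) (m : nat) (G : {group 'S_m})
    (lambda : 'S_m -> R[i]) : R[i] :=
  (#|G|%:R)^-1 * \sum_(g in G) lambda g.

(* [s] permutes [O] cyclically and fixes everything else. Naming the orbit
   lets a cycle of length 1 (the identity, with [O] a singleton) be disjoint
   from other cycles in the usual sense; for length at least 2, [O] is
   necessarily the support of [s]. *)
Definition cycle_on (m : nat) (O : {set 'I_m}) (s : 'S_m) : bool :=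
  (O \in porbits s) && perm_on O s.

Definition disjoint_cycles (m k : nat) (sigma : 'I_k -> 'S_m) : Prop :=
  exists2 O : 'I_k -> {set 'I_m},
    forall l, cycle_on (O l) (sigma l) &
    forall l l', l != l' -> [disjoint O l & O l'].

(* The character lambda_(q_1, ..., q_k): an element of <sigma_1>...<sigma_k>
   is written sigma_1^(j_1) ... sigma_k^(j_k) with 0 <= j_l < m_l. The value 0
   is only taken outside of <sigma_1>...<sigma_k>. Lemma [cycle_charE] gives the
   value for arbitrary exponents, so the choice of the j_l is immaterial. *)
Definition cycle_char (R : realType) (m k : nat) (sigma : 'I_k -> 'S_m)
    (q : 'I_k -> nat) (tau : 'S_m) : R[i] :=
  if [pick j : {dffun forall l : 'I_k, 'I_#[sigma l]%g}
        | tau == (\prod_(l < k) sigma l ^+ j l)%g] is Some j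
  then \prod_(l < k)
         expi (2 * pi * (q l)%:R * (j l : nat)%:R / #[sigma l]%g%:R : R)
  else 0.

Lemma expi_modn (R : realType) (q n j : nat) : (0 < n)%N ->
  expi (2 * pi * q%:R * (j %% n)%N%:R / n%:R : R) =
  expi (2 * pi * q%:R * j%:R / n%:R).
Proof.
move=> n0; have nz : n%:R != 0 :> R by rewrite pnatr_eq0 -lt0n.
have -> : 2 * pi * q%:R * j%:R / n%:R =
  2 * pi * q%:R * (j %% n)%N%:R / n%:R + (pi *+ 2) *+ (q * (j %/ n)) :> R.
  rewrite {1}(divn_eq j n) natrD !natrM mulrDr mulrDl addrC; congr (_ + _).
  rewrite -[(pi *+ 2) *+ _]mulr_natr natrM -[pi *+ 2]mulr_natl !mulrA.
  by rewrite mulfK.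
by rewrite /expi (periodicn (@cosD2pi R)) (periodicn (@sinD2pi R)).
Qed.

Lemma disjoint_cycles_prod (m k : nat) (sigma : 'I_k -> 'S_m)
    (O : 'I_k -> {set 'I_m}) (j : 'I_k -> nat) (l : 'I_k) (x : 'I_m) :
  (forall l, cycle_on (O l) (sigma l)) ->
  (forall l l', l != l' -> [disjoint O l & O l']) ->
  x \in O l -> (\prod_(i < k) sigma i ^+ j i)%g x = (sigma l ^+ j l)%g x.
Proof.
move=> cO dO.
have pX i n : perm_on (O i) (sigma i ^+ n)%g.
  have /andP[_ pi] := cO i; elim: n => [|n IHn]; first exact: perm_on1.
  by rewrite expgS perm_onM.
suff H (r : seq 'I_k) : uniq r -> forall x, x \in O l ->
    (\prod_(i <- r) sigma i ^+ j i)%g x =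
    if l \in r then (sigma l ^+ j l)%g x else x.
  by move=> xO; rewrite H ?index_enum_uniq ?mem_index_enum.
elim: r => [_ y _|i r IHr /= /andP[ir ur] y yO]; first by rewrite big_nil perm1.
rewrite big_cons permM in_cons; have [il|li] /= := eqVneq l i.
  rewrite -{}il in ir *.
  by rewrite IHr ?(perm_closed _ (pX l _)) // (negPf ir).
rewrite (out_perm (pX i _)) ?IHr //.
by apply: contraTN yO => yO; rewrite (disjointFl (dO _ _ li)).
Qed.

Lemma cycle_charE (R : realType) (m k : nat) (sigma : 'I_k -> 'S_m)
    (q j : 'I_k -> nat) : disjoint_cycles sigma ->
  cycle_char R sigma q (\prod_(l < k) sigma l ^+ j l)%g =
  \prod_(l < k) expi (2 * pi * (q l)%:R * (j l)%:R / #[sigma l]%g%:R : R).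
Proof.
case=> Os cO dO; rewrite /cycle_char; case: pickP => [j' /eqP e|].
  apply: eq_bigr => l _.
  have es : (sigma l ^+ j l = sigma l ^+ j' l)%g.
    apply/permP => x; have [xO|xO] := boolP (x \in Os l).
      have H j0 := disjoint_cycles_prod j0 cO dO xO.
      by rewrite -H e (H (fun i => j' i : nat)).
    have out n : (sigma l ^+ n)%g x = x.
      have /andP[_ p] := cO l; elim: n => [|n IHn]; first by rewrite perm1.
      by rewrite expgS permM (out_perm p).
    by rewrite !out.
  move/eqP: es; rewrite eq_expg_mod_order => /eqP es.
  by rewrite -expi_modn ?order_gt0 // -es expi_modn ?order_gt0.
pose j' : {dffun forall l : 'I_k, 'I_#[sigma l]%g} :=
  [ffun l => Ordinal (ltn_pmod (j l) (order_gt0 (sigma l)))].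
move/(_ j')/eqP; case; apply: eq_bigr => l _.
by rewrite ffunE /= expg_mod_order.
Qed.

(* Main.v *)
(* The symmetrizer is [M \otimes id_V], where the m x m matrix [M] averages the
   permutation matrices of [G] against [lambda]; hence
   [dim V^lambda(G) = rank M * dim V]. As [lambda] is multiplicative, [M] is
   idempotent, so its rank is its trace, the sum over the points [x] of
   [|G|^-1 * \sum_(t in Stab x) lambda t]. A point outside all the cycles
   contributes [[lambda, 1_G]]. For [x] in the j-th cycle, the stabilizer is the
   product of the other cyclic groups, so the sum factors into the sums
   [\sum_(e < m_l) exp(2 i pi q_l e / m_l)] for [l != j], and grouping [e] by
   [gcd(e, m_l)] turns each of these into a sum of Ramanujan sums. *)

Require Import Defs.
From HB Require Import structures.
From mathcomp Require Import all_boot all_order all_algebra all_fingroup.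
From mathcomp Require Import cyclic sesquilinear complex.
From mathcomp Require Import all_classical all_reals all_analysis.

Set Implicit Arguments.
Unset Strict Implicit.
Unset Printing Implicit Defensive.

Import Order.TTheory GRing.Theory Num.Theory.
Local Open Scope ring_scope.

(** * Ranks, traces and matrices acting on tuples of vectors *)

(** In a full-rank factorization [A = C *m B], idempotence reads [C *m (B *m C) *m B = C *m B].
    Cancelling [C] and [B] gives [B *m C = 1], an identity matrix of size [\rank A] with the same
    trace as [A]. *)
Lemma mxtrace_idempotent (F : fieldType) (n : nat) (A : 'M[F]_n) :
  A *m A = A -> \tr A = (\rank A)%:R.
Proof.
move=> AA; have BC1 : row_base A *m col_base A = 1%:M.
  apply: (row_full_inj (col_base_full A)).
  apply: (row_free_inj (row_base_free A)).
  by rewrite mulmx1 mulmxA -mulmxA !mulmx_base.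
by rewrite -{1}(mulmx_base A) mxtrace_mulC BC1 mxtrace1.
Qed.

Section MatrixAction.
Variables (F : fieldType) (V : vectType F).

Definition mxact (p n : nat) (A : 'M[F]_(p, n)) (u : {ffun 'I_n -> V}) :
    {ffun 'I_p -> V} :=
  [ffun i => \sum_j A i j *: u j].

Lemma mxact_is_linear (p n : nat) (A : 'M[F]_(p, n)) : linear (mxact A).
Proof.
move=> a u v; apply/ffunP => i; rewrite !ffunE scaler_sumr -big_split.
by apply: eq_bigr => j _; rewrite !ffunE scalerDr !scalerA mulrC.
Qed.

HB.instance Definition _ (p n : nat) (A : 'M[F]_(p, n)) :=
  GRing.isLinear.Build F {ffun 'I_n -> V} {ffun 'I_p -> V} _
    (mxact A) (mxact_is_linear A).

Lemma mxactM (p n r : nat) (A : 'M[F]_(p, n)) (B : 'M[F]_(n, r)) u :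
  mxact (A *m B) u = mxact A (mxact B u).
Proof.
apply/ffunP => i; rewrite !ffunE.
under [RHS]eq_bigr do rewrite ffunE scaler_sumr.
rewrite exchange_big; apply: eq_bigr => j _; rewrite mxE scaler_suml.
by apply: eq_bigr => l _; rewrite scalerA.
Qed.

Lemma mxact1 (n : nat) u : mxact (1%:M : 'M[F]_n) u = u.
Proof.
apply/ffunP => i; rewrite ffunE (bigD1 i) //= big1.
  by rewrite mxE eqxx scale1r addr0.
by move=> j ji; rewrite mxE eq_sym (negPf ji) scale0r.
Qed.

(** The full-rank factorization of [A] makes the action a surjection onto [\rank A] copies of [V],
    followed by an injection. *)
Lemma dim_limg_mxact (p n : nat) (A : 'M[F]_(p, n)) :
  \dim (limg (linfun (mxact A))) = (\rank A * \dim {:V})%N.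
Proof.
have -> : linfun (mxact A) =
    (linfun (mxact (col_base A)) \o linfun (mxact (row_base A)))%VF.
  apply/lfunP => u; rewrite comp_lfunE !lfunE /=.
  by rewrite -{1}(mulmx_base A) mxactM.
rewrite limg_comp.
have -> : limg (linfun (mxact (row_base A))) = fullv.
  apply/eqP; rewrite eqEsubv subvf /=; apply/subvP => v _.
  apply/memv_imgP; exists (mxact (pinvmx (row_base A)) v); first exact: memvf.
  by rewrite lfunE /= -mxactM mulmxVp ?row_base_free // mxact1.
rewrite limg_dim_eq.
  by rewrite !dimvf /dim /= card_ord.
apply/eqP; rewrite -subv0; apply/subvP => u; rewrite memv_cap memv_ker lfunE /=.
case/andP => _ /eqP u0; rewrite memv0 -(mxact1 u).
by rewrite -(mulVpmx (col_base_full A)) mxactM u0 linear0.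
Qed.

End MatrixAction.

(** * The symmetrizer of a multiplicative character as an idempotent matrix *)

Section SymmetryClass.
Variables (R : realType) (V : vectType R[i]) (m : nat).
Variables (G : {group 'S_m}) (lambda : 'S_m -> R[i]).
Hypothesis lambdaM : {in G &, {morph lambda : s t / (s * t)%g >-> s * t}}.
Hypothesis lambda1 : lambda 1%g = 1.

Definition symmetrizer_mx : 'M[R[i]]_m :=
  (#|G|%:R)^-1 *: \sum_(tau in G) lambda tau *: perm_mx (tau^-1)%g.

Lemma cart_symmetrizerE :
  cart_symmetrizer V G lambda = linfun (mxact symmetrizer_mx).
Proof.
apply/lfunP => u; rewrite [RHS]lfunE /cart_symmetrizer /= scale_lfunE sum_lfunE.
rewrite lambda1 mul1r.
apply/ffunP => i; rewrite !ffunE sum_ffunE.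
under [RHS]eq_bigr do rewrite mxE -scalerA.
rewrite -scaler_sumr; congr (_ *: _).
under [RHS]eq_bigr do rewrite summxE scaler_suml.
rewrite exchange_big; apply: eq_bigr => t tG.
rewrite scale_lfunE ffunE QpermE.
rewrite [RHS](bigD1 ((t^-1)%g i)) //= big1 ?addr0.
  by rewrite !mxE eqxx mulr1.
by move=> j ji; rewrite !mxE eq_sym (negPf ji) mulr0 scale0r.
Qed.

Lemma symmetrizer_mx_idem : symmetrizer_mx *m symmetrizer_mx = symmetrizer_mx.
Proof.
have G0 : #|G|%:R != 0 :> R[i] by rewrite pnatr_eq0 -lt0n cardG_gt0.
rewrite /symmetrizer_mx -scalemxAl -scalemxAr; congr (_ *: _).
set S := \sum_(tau in G) _.
(* Each of the [#|G|] summands of the left factor, multiplied by [S], gives back [S], by the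
   reindexing [s -> s * t]. *)
suff -> : S *m S = #|G|%:R *: S by rewrite scalerA mulVf // scale1r.
rewrite {1}/S mulmx_suml scaler_nat -sumr_const; apply: eq_bigr => t tG.
rewrite mulmx_sumr [RHS](reindex_inj (mulIg t)) /=.
apply: eq_big => [s|s sG]; first by rewrite groupMr.
rewrite lambdaM // invMg perm_mxM -scalemxAl -scalemxAr scalerA.
by rewrite mulrC.
Qed.

Lemma dim_cart_symmetry_class :
  (\dim (cart_symmetry_class V G lambda))%:R = (\dim {:V})%:R *
    \sum_i ((#|G|%:R)^-1 * \sum_(tau in G | tau i == i) lambda tau) :> R[i].
Proof.
rewrite /cart_symmetry_class cart_symmetrizerE dim_limg_mxact natrM mulrC.
rewrite -(mxtrace_idempotent symmetrizer_mx_idem); congr (_ * _).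
apply: eq_bigr => i _; rewrite mxE summxE; congr (_ * _).
rewrite [RHS]big_mkcondr; apply: eq_bigr => t _; rewrite !mxE.
by rewrite (can2_eq (permKV t) (permK t)) eq_sym; case: eqP => _;
  rewrite ?mulr1 ?mulr0.
Qed.

End SymmetryClass.

(** * Products of powers of disjoint cycles *)

Lemma perm_onX (T : finType) (S : {set T}) (s : {perm T}) (n : nat) :
  perm_on S s -> perm_on S (s ^+ n)%g.
Proof.
by move=> Ss; elim: n => [|n IHn]; rewrite ?perm_on1 // expgS perm_onM.
Qed.

Section CycleOn.
Variables (m : nat) (O : {set 'I_m}) (s : 'S_m).
Hypothesis cOs : cycle_on O s.

(** A power of [s] commutes with [s], so if it fixes one point of the orbit [O] it fixes them all;
    outside [O] it is trivial anyway. *)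
Lemma cycle_on_expg_eq1 (x : 'I_m) (n : nat) :
  x \in O -> ((s ^+ n)%g x == x) = (#[s]%g %| n)%N.
Proof.
move: cOs => /andP[/imsetP[z _ ->] /(perm_onX n) sn].
rewrite -eq_porbit_mem => /eqP Ox; rewrite order_dvdn.
apply/eqP/eqP => [xn|->]; last by rewrite perm1.
apply/permP => y; rewrite perm1.
have [|yO] := boolP (y \in porbit s z); last by rewrite (out_perm sn).
rewrite -Ox => /porbitP[i ->].
by rewrite -permM -expgD addnC expgD permM xn.
Qed.

(** The power of exponent [#|O|] fixes a point of [O], so the order divides [#|O|]; conversely, [O]
    is the image of [<[s]>] under evaluation at a point. *)
Lemma order_cycle_on : #[s]%g = #|O|.
Proof.
have /andP[/imsetP[z _ Oz] _] := cOs.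
apply/eqP; rewrite eqn_leq; apply/andP; split.
  apply: dvdn_leq; first by rewrite Oz lt0n card_porbit_neq0.
  rewrite -(@cycle_on_expg_eq1 z) ?Oz ?porbit_id // permX.
  by rewrite iter_porbit.
by rewrite Oz porbit.unlock leq_imset_card.
Qed.

End CycleOn.

Definition cycle_word (m k : nat) (sigma : 'I_k -> 'S_m) (j : 'I_k -> nat) :=
  (\prod_(l < k) sigma l ^+ j l)%g.

Section DisjointCycles.
Variables (m k : nat) (sigma : 'I_k -> 'S_m) (O : 'I_k -> {set 'I_m}).
Hypothesis cO : forall l, cycle_on (O l) (sigma l).
Hypothesis dO : forall l l', l != l' -> [disjoint O l & O l'].

Local Notation word := (cycle_word sigma).

Lemma cycle_word_in (j : 'I_k -> nat) (l : 'I_k) (x : 'I_m) :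
  x \in O l -> word j x = (sigma l ^+ j l)%g x.
Proof. exact: disjoint_cycles_prod. Qed.

Lemma cycle_word_out (j : 'I_k -> nat) (x : 'I_m) :
  (forall l, x \notin O l) -> word j x = x.
Proof.
move=> xO; rewrite /cycle_word; elim/big_ind: _ => [|s t sx tx|l _].
- by rewrite perm1.
- by rewrite permM sx.
- by have /andP[_ /perm_onX/out_perm->] := cO l.
Qed.

Lemma cycle_wordM (i j : 'I_k -> nat) :
  (word i * word j)%g = word (fun l => i l + j l)%N.
Proof.
apply/permP => x; rewrite permM.
have [/existsP[l xl]|/existsPn xO] := boolP [exists l, x \in O l].
  have /andP[_ /perm_onX p] := cO l.
  rewrite (cycle_word_in i xl) !(@cycle_word_in _ l) ?(perm_closed _ (p _)) //.
  by rewrite expgD permM.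
by rewrite !cycle_word_out.
Qed.

(** Restricting a word to [O l] recovers its l-th factor. Exponents below the orders are thus
    unique, which turns sums over the group into sums over exponents. *)
Lemma cycle_word_inj (i j : 'I_k -> nat) (l : 'I_k) :
  word i = word j -> i l = j l %[mod #[sigma l]%g].
Proof.
move=> e; apply/eqP; rewrite -eq_expg_mod_order; apply/eqP/permP => x.
have [xO|xO] := boolP (x \in O l); first by rewrite -!cycle_word_in // e.
by have /andP[_ /perm_onX p] := cO l; rewrite !(out_perm (p _)).
Qed.

(* Every exponent is below [#[sigma l]], which is at most [m]; the common
   bound [m.+1] avoids dependent function spaces. *)
Definition cycle_exponents : pred {ffun 'I_k -> 'I_m.+1} :=
  family (fun l (e : 'I_m.+1) => (e < #[sigma l]%g)%N).

Lemma cycle_prod_imset :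
  (\prod_(l < k) <[sigma l]>)%g =
  [set word (fun l => f l) |
    f : {ffun 'I_k -> 'I_m.+1} in cycle_exponents].
Proof.
apply/setP => t; apply/prodsgP/imsetP => [[c cP ->]|[f _ ->]]; last first.
  by exists (fun l => sigma l ^+ f l)%g => // l _; exact: mem_cycle.
have ltm l n : (n < #[sigma l]%g -> n < m.+1)%N.
  move/leq_trans; apply; rewrite (order_cycle_on (cO l)) ltnW // ltnS.
  by rewrite -[leqRHS]card_ord max_card.
have ex l : exists2 e : 'I_m.+1, (e < #[sigma l]%g)%N & c l = (sigma l ^+ e)%g.
  have /cyclePmin[n n_lt ->] := cP l isT.
  by exists (Ordinal (ltm l n n_lt)).
exists [ffun l => s2val (cid2 (ex l))].
  by apply/familyP => l; rewrite ffunE; case: cid2.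
by apply: eq_bigr => l _; rewrite ffunE; case: cid2.
Qed.

Lemma big_cycle_prod (S : nmodType) (F : 'S_m -> S) :
  \sum_(t in (\prod_(l < k) <[sigma l]>)%g) F t =
  \sum_(f in cycle_exponents) F (word (fun l => f l)).
Proof.
rewrite cycle_prod_imset big_imset // => f g /familyP fP /familyP gP e.
apply/ffunP => l; apply: val_inj.
by have := cycle_word_inj l e; rewrite !modn_small //; [apply: gP | apply: fP].
Qed.

End DisjointCycles.

(* The fractions [e / n] with [gcdn e n = d] are the reduced fractions with
   denominator [n %/ d]. *)
Lemma sum_ramanujan_sum (R : realType) (n q : nat) : (0 < n)%N ->
  \sum_(d <- divisors n) ramanujan_sum R (n %/ d) q =
  \sum_(e < n) expi (2 * pi * q%:R * e%:R / n%:R : R).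
Proof.
move=> n0; pose E (e : nat) := expi (2 * pi * q%:R * e%:R / n%:R : R).
transitivity (\sum_(e < n) \sum_(d <- divisors n | gcdn e n == d) E e);
  last first.
  apply: eq_bigr => e _.
  rewrite big_mkcond (bigD1_seq (gcdn e n)) ?divisors_uniq //=.
    by rewrite eqxx big1 ?addr0 // => d; rewrite eq_sym => /negPf->.
  by rewrite -dvdn_divisors // dvdn_gcdr.
rewrite (exchange_big_dep predT) //=; apply: eq_big_seq => d.
rewrite -dvdn_divisors // => dn; have d0 := dvdn_gt0 n0 dn.
have hP (s : 'I_(n %/ d)) : (s * d < n)%N by rewrite -ltn_divRL.
have gP (e : 'I_n) : (e %/ d < n %/ d)%N by rewrite ltn_divLR // divnK.
(* Put [e = s * d]: since [gcdn (s * d) n = gcdn s (n %/ d) * d], the condition on [e] becomes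
   coprimality of [s] and [n %/ d]. *)
rewrite (reindex_onto (fun s => Ordinal (hP s)) (fun e => Ordinal (gP e))) /=.
  apply: eq_big => [s|s _].
    have -> : Ordinal (gP (Ordinal (hP s))) = s by apply: val_inj; exact: mulnK.
    have -> : gcdn (s * d) n = (gcdn s (n %/ d) * d)%N.
      by rewrite muln_gcdl divnK.
    by rewrite eqxx andbT -[X in _ == X]mul1n eqn_pmul2r.
  have nE : n%:R = (n %/ d)%:R * d%:R :> R by rewrite -natrM divnK.
  congr expi; rewrite nE natrM.
  by rewrite invfM !mulrA (mulrAC _ d%:R) mulfK // pnatr_eq0 -lt0n.
move=> e /eqP ed; apply: val_inj => /=.
by rewrite divnK // -ed dvdn_gcdl.
Qed.

(** * Character sums over point stabilizers *)

Section CycleChar.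
Variables (R : realType) (m k : nat) (sigma : 'I_k -> 'S_m).
Variables (O : 'I_k -> {set 'I_m}) (q : 'I_k -> nat) (G : {group 'S_m}).
Hypothesis cO : forall l, cycle_on (O l) (sigma l).
Hypothesis dO : forall l l', l != l' -> [disjoint O l & O l'].
Hypothesis G_prod : (G :=: \prod_(l < k) <[sigma l]>)%g.

Local Notation lambda := (cycle_char R sigma q).
Local Notation E l e :=
  (expi (2 * pi * (q l)%:R * e%:R / #[sigma l]%g%:R : R)).

Let E0 l : E l 0%N = 1.
Proof. by rewrite mulr0 mul0r /expi cos0 sin0. Qed.

Let ED l a b : E l (a + b)%N = E l a * E l b.
Proof.
rewrite natrD mulrDr mulrDl /expi cosD sinD.
by apply/eqP; rewrite eq_complex /= eqxx addrC eqxx.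
Qed.

Let sigma_disj : disjoint_cycles sigma. Proof. by exists O. Qed.

Lemma cycle_char1 : lambda 1%g = 1.
Proof.
have -> : 1%g = (\prod_(l < k) sigma l ^+ 0)%g :> 'S_m by rewrite big1.
rewrite (cycle_charE R q (fun=> 0%N) sigma_disj).
by apply: big1 => l _; exact: E0.
Qed.

Lemma cycle_charM : {in G &, {morph lambda : s t / (s * t)%g >-> s * t}}.
Proof.
move=> s t; rewrite !G_prod !(cycle_prod_imset cO) => /imsetP[f _ ->].
case/imsetP => g _ ->; rewrite (cycle_wordM cO dO).
rewrite !cycle_charE // -big_split; apply: eq_bigr => l _.
exact: ED.
Qed.

Lemma sum_cycle_char_fix (j : 'I_k) (x : 'I_m) : x \in O j ->
  \sum_(t in G | t x == x) lambda t =
  \prod_(l < k | l != j) \sum_(e < #[sigma l]%g) E l e.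
Proof.
move=> xO; rewrite big_mkcondr G_prod (big_cycle_prod cO dO) -big_mkcondr /=.
(* A word fixes [x] exactly when its j-th exponent is divisible by the order of [sigma j], that is,
   when this reduced exponent is 0. The constraint bears on each exponent separately, so the sum
   distributes into a product. *)
transitivity (\prod_(l < k) \sum_(e < m.+1 |
    (e < #[sigma l]%g)%N && ((l == j) ==> (e == ord0))) E l e).
  rewrite bigA_distr_big_dep; apply: eq_big => [f|f _]; last first.
    by rewrite (cycle_charE R q (fun l => f l) sigma_disj).
  rewrite (cycle_word_in cO dO _ xO) (cycle_on_expg_eq1 (cO j)) //.
  apply/andP/familyP => [[/familyP fP jf] l|fP].
    rewrite !unfold_in; have := fP l; rewrite !unfold_in => fl.
    rewrite fl; apply/implyP => /eqP lj; rewrite -val_eqE /=.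
    by move: jf fl; rewrite -lj /dvdn => /eqP + /modn_small => -> <-.
  split; first by apply/familyP => l; have /andP[] := fP l.
  by have /andP[_ /implyP/(_ (eqxx _))/eqP->] := fP j; exact: dvdn0.
rewrite (bigD1 j) //= (big_pred1 ord0) ?E0 ?mul1r => [|e]; last first.
  by rewrite eqxx /=; case: eqP => [->|]; rewrite ?order_gt0 ?andbF.
apply: eq_bigr => l lj; rewrite (negPf lj) /=.
under eq_bigl do rewrite andbT.
rewrite -(big_ord_widen _ (fun e => E l e)) // (order_cycle_on (cO l)) leqW //.
by rewrite -[leqRHS]card_ord max_card.
Qed.

Lemma card_cycle_prod : #|G| = (\prod_(l < k) #[sigma l]%g)%N.
Proof.
rewrite -sum1_card G_prod (big_cycle_prod cO dO).
(* Each order is written as a sum of ones over the exponents, so that the product expands into a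
   count of exponent families. *)
under [RHS]eq_bigr => l _.
  rewrite -[#[sigma l]%g]card_ord -sum1_card.
  rewrite (big_ord_widen m.+1 (fun=> 1%N)).
  over.
  rewrite (order_cycle_on (cO l)) leqW //.
  by rewrite -[leqRHS]card_ord max_card.
rewrite bigA_distr_big_dep; apply: eq_bigr => f _.
by rewrite big1.
Qed.

End CycleChar.
Theorem theorem3p3 (R : realType) (V : vectType R[i])
    (form : {dot V for @Num.conj R[i]})
    (dimV : (2 <= \dim {:V})%N)
    (m k : nat) (sigma : 'I_k -> 'S_m) (G : {group 'S_m})
    (ms q : 'I_k -> nat)
    (sigma_cycles : disjoint_cycles sigma)
    (sigma_order : forall l, #[sigma l]%g = ms l)
    (G_prod : (G :=: \prod_(l < k) <[sigma l]>)%g)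
    (q_lt : forall l, (q l <= ms l - 1)%N) :
  let lambda := cycle_char R sigma q in
  ((2 <= k)%N ->
   (\dim (cart_symmetry_class V G lambda))%:R =
     (\dim {:V})%:R *
     ((m%:R - \sum_(l < k) (ms l)%:R) * char_dot1 G lambda +
      \sum_(j < k) \prod_(l < k | l != j)
        ((ms l)%:R^-1 *
         \sum_(d <- divisors (ms l)) ramanujan_sum R (ms l %/ d) (q l)))
     :> R[i]) /\
  (k = 1%N -> forall l : 'I_k,
   (\dim (cart_symmetry_class V G lambda))%:R =
     (\dim {:V})%:R * ((m%:R - (ms l)%:R) * char_dot1 G lambda + 1) :> R[i]).
Proof.
move=> lambda; have [Os cO dO] := sigma_cycles.
have ms_gt0 l : (0 < ms l)%N by rewrite -sigma_order order_gt0.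
have main : (\dim (cart_symmetry_class V G lambda))%:R =
     (\dim {:V})%:R *
     ((m%:R - \sum_(l < k) (ms l)%:R) * char_dot1 G lambda +
      \sum_(j < k) \prod_(l < k | l != j)
        ((ms l)%:R^-1 *
         \sum_(d <- divisors (ms l)) ramanujan_sum R (ms l %/ d) (q l)))
     :> R[i].
  rewrite (dim_cart_symmetry_class _ (cycle_charM R q cO dO G_prod));
    last exact: (cycle_char1 R q cO dO).
  (* Points outside all the orbits are fixed by the whole of [G]; they are treated first. *)
  congr (_ * _); rewrite (bigID (mem (\bigcup_l Os l))) /= addrC; congr (_ + _).
    under eq_bigr => i /bigcupP iO.
      rewrite (eq_bigl (mem G)) => [|t]; last first.
        apply: andb_idr; rewrite G_prod (cycle_prod_imset cO).
        case/imsetP => f _ ->; rewrite (cycle_word_out cO) // => l.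
        by apply: contra_notN iO => il; exists l.
      over.
    rewrite sumr_const -[LHS]mulr_natl; congr (_ * _).
    have -> : \sum_(l < k) (ms l)%:R = #|\bigcup_l Os l|%:R :> R[i].
      rewrite -sum1_card partition_disjoint_bigcup // natr_sum.
      apply: eq_bigr => l _.
      by rewrite sum1_card -(order_cycle_on (cO l)) sigma_order.
    apply/eqP; rewrite eq_sym subr_eq addrC -natrD -[X in X%:R == _]card_ord.
    by rewrite -(cardC (mem (\bigcup_l Os l))).
  rewrite partition_disjoint_bigcup //; apply: eq_bigr => j _.
  under eq_bigr => i iO do rewrite (sum_cycle_char_fix R q cO dO G_prod iO).
  (* The points of the j-th orbit contribute equally, and their number cancels the j-th factor of
     [#|G|], leaving one inverse order for each [l != j]. *)
  rewrite sumr_const -(order_cycle_on (cO j)).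
  rewrite (card_cycle_prod cO dO G_prod) natr_prod (bigD1 j) //=.
  rewrite invfM -[LHS]mulr_natl.
  rewrite !mulrA divff ?mul1r ?pnatr_eq0 -?lt0n ?order_gt0 //.
  rewrite -prodfV -big_split; apply: eq_bigr => l _ /=.
  by rewrite sum_ramanujan_sum // sigma_order.
(* For a single cycle the product over [l != j] is empty, which gives the summand 1. *)
split=> // k1 l; subst k; rewrite main; congr (_ * (_ * _ + _)).
  by rewrite big_ord1 (ord1 l).
by rewrite big_ord1 big_pred0 // => i; rewrite (ord1 i).
Qed.
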